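(* Let $\Omega$, $F$, $K$ be as in the context. Suppose that $\Omega$ is convex and satisfies $\Omega\subseteq\operatorname{int}\operatorname{dom}F$. Furthermore, assume that $\operatorname{gph}F:=\{(x,y)\in\mathbb{R}^n\times\mathbb{R}^m: y\in F(x)\}$ is convex, and that $F$ is locally bounded at every point of $\Omega$. Then $(\mathcal{SP})$ satisfies (wFDVP) with $p:=n+1$, that is, $\operatorname{wargmin}_x(\mathcal{VP}_{n+1})=\operatorname{wargmin}(\mathcal{SP})$.
   Context: $\mathbb{N}=\{1,2,\ldots\}$ and $[p]=\{1,\ldots,p\}$. Setting: $\Omega\subseteq\mathbb{R}^n$ is nonempty and closed; $F:\mathbb{R}^n\rightrightarrows\mathbb{R}^m$ is a set-valued mapping with $\Omega\subseteq \operatorname{dom}F:=\{x: F(x)\neq\emptyset\}$ and $F(x)$ compact for every $x\in\Omega$; $K\subseteq\mathbb{R}^m$ is a closed, convex, pointed ($K\cap(-K)=\{0\}$), solid ($\operatorname{int}K\ne\emptyset$) cone. $F$ is locally bounded at $\bar x$ if there exist $\alpha>0$ and a neighborhood $U$ of $\bar x$ with $\bigcup_{x\in U}F(x)\subseteq\alpha\mathbb{B}$, where $\mathbb{B}$ is the Euclidean unit ball of $\mathbb{R}^m$. Set optimization problem $(\mathcal{SP})$: minimize $F(x)$ over $x\in\Omega$ with respect to the lower set less relation. A point $\bar x\in\Omega$ is a weakly minimal solution of $(\mathcal{SP})$, written $\bar x\in\operatorname{wargmin}(\mathcal{SP})$, if there is no $x\in\Omega$ with $F(\bar x)\subseteq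 F(x)+\operatorname{int}K$. Multiobjective problem $(\mathcal{VP}_p)$, $p\in\mathbb{N}$: minimize $(y^1,\ldots,y^p)\in\mathbb{R}^{mp}$ with respect to the cone $K^p=\prod_{i=1}^pK$ over all feasible $(x,y^1,\ldots,y^p)$, i.e. $x\in\Omega$ and $y^i\in F(x)$ for all $i\in[p]$. A feasible $(\bar x,\bar y^1,\ldots,\bar y^p)$ is a weakly minimal solution if there is no feasible $(x,y^1,\ldots,y^p)$ with $\bar y^i-y^i\in\operatorname{int}K$ for all $i\in[p]$. The set $\operatorname{wargmin}_x(\mathcal{VP}_p)$ is the projection onto the $x$-component in $\mathbb{R}^n$ of the set of weakly minimal solutions of $(\mathcal{VP}_p)$. $(\mathcal{SP})$ satisfies the weakly minimal finite dimensional vectorization property (wFDVP) if there exists $p\in\mathbb{N}$ with $\operatorname{wargmin}_x(\mathcal{VP}_p)=\operatorname{wargmin}(\mathcal{SP})$; it satisfies it with a given $p$ if this equality holds for that $p$. *)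

(* Defs.v *)
From HB Require Import structures.
From mathcomp Require Import all_boot all_order all_algebra.
From mathcomp Require Import all_classical all_reals all_analysis.

Import Order.TTheory GRing.Theory Num.Theory.
Import numFieldNormedType.Exports.

Local Open Scope classical_set_scope.
Local Open Scope ring_scope.

Section Cones.
Context {R : realType} {m : nat}.
Implicit Types A B K : set 'rV[R]_m.

Definition minkowski_sum A B : set 'rV[R]_m := [set a + b | a in A & b in B].

Definition is_cone K : Prop :=
  K !=set0 /\ forall (t : R) (x : 'rV[R]_m), 0 <= t -> K x -> K (t *: x).

Definition is_pointed K : Prop := K `&` [set - x | x in K] = [set 0].

Definition is_solid K : Prop := interior K !=set0.

(* The norm `|y| of the library on 'rV[R]_m is the sup norm. *)
Definition eucl_norm (y : 'rV[R]_m) : R := Num.sqrt (\sum_(i < m) y 0 i ^+ 2).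

Definition eucl_unit_ball : set 'rV[R]_m := [set y | eucl_norm y <= 1].

End Cones.

Section SetValuedMaps.
Context {R : realType} {n m : nat}.
Implicit Type F : 'rV[R]_n -> set 'rV[R]_m.

Definition svdom F : set 'rV[R]_n := [set x | F x !=set0].

Definition svgraph F : set ('rV[R]_n * 'rV[R]_m)%type := [set z | F z.1 z.2].

Definition locally_bounded_at F (xbar : 'rV[R]_n) : Prop :=
  exists alpha : R, 0 < alpha /\
    exists U : set 'rV[R]_n, nbhs xbar U /\
      \bigcup_(x in U) F x `<=` [set alpha *: y | y in eucl_unit_ball].

End SetValuedMaps.

Section Problems.
Context {R : realType} {n m : nat}.
Variables (Omega : set 'rV[R]_n) (F : 'rV[R]_n -> set 'rV[R]_m)
  (K : set 'rV[R]_m).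

Definition wargmin_SP : set 'rV[R]_n :=
  [set xbar | Omega xbar /\
     ~ exists x, Omega x /\ F xbar `<=` minkowski_sum (F x) (interior K)].

(* A point (x, y^1, ..., y^p) is encoded as z with x = z.1 and the y^i being
   the values z.2 i, the indices i being shifted to 0, ..., p - 1. *)
Definition feasible_VP (p : nat)
    : set ('rV[R]_n * ('I_p -> 'rV[R]_m))%type :=
  [set z | Omega z.1 /\ forall i, F z.1 (z.2 i)].

Definition wargmin_VP (p : nat) : set ('rV[R]_n * ('I_p -> 'rV[R]_m))%type :=
  [set zbar | feasible_VP p zbar /\
     ~ exists z, feasible_VP p z /\ forall i, interior K (zbar.2 i - z.2 i)].

Definition wargminx_VP (p : nat) : set 'rV[R]_n := fst @` wargmin_VP p.

Definition wFDVP_with (p : nat) : Prop := wargminx_VP p = wargmin_SP.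

End Problems.

(* Main.v *)
(* Only the inclusion of wargmin (SP) in wargmin_x (VP_(n+1)) needs an argument.
   Fix xbar weakly minimal for (SP). For y in F xbar the set
     C y = {x in Omega | y in F x + int K}
   is convex, because gph F is, and weak minimality of xbar says that the C y
   have no common point. If finitely many points x_1, ..., x_N of Omega met
   every intersection of n+1 of the C y, then Helly's theorem would give the C y
   a common point: group them into finitely many convex sets according to which
   of the x_j they contain. Hence for any finite subset of Omega, some n+1
   points y^i of F xbar have no x of that subset in all the C (y^i). As
   F x + int K is open and F xbar ^ (n+1) is compact, the finite intersection
   property upgrades this to all of Omega. *)
Require Import Defs.
From HB Require Import structures.
From mathcomp Require Import all_boot all_order all_algebra.
From mathcomp Require Import finmap all_classical all_reals all_analysis.

Set Implicit Arguments.
Unset Strict Implicit.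
Unset Printing Implicit Defensive.

Import Order.TTheory GRing.Theory Num.Theory.
Import numFieldNormedType.Exports.

Local Open Scope classical_set_scope.
Local Open Scope ring_scope.

Lemma convex_setE (R : realType) (E : lmodType R) (A : set E) :
  convex_set A <->
  forall (t : R) x y, 0 <= t <= 1 -> A x -> A y -> A (t *: x + (1 - t) *: y).
Proof.
split=> [cA t x y /andP[t0 t1] Ax Ay|cA x y t].
  by have := cA x y (Itv01 t0 t1); rewrite !inE; apply.
rewrite !inE => Ax Ay; apply: (cA t%:num) => //.
by rewrite ge0 le1.
Qed.

Lemma convex_set_weighted_mean (R : realType) (E : lmodType R) (A : set E)
    (I : finType) (P : pred I) (w : I -> R) (p : I -> E) :
  convex_set A -> (forall i, P i -> 0 < w i /\ A (p i)) ->
  0 < \sum_(i | P i) w i ->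
  A ((\sum_(i | P i) w i)^-1 *: \sum_(i | P i) w i *: p i).
Proof.
move=> /convex_setE cA wp.
(* An empty sum has no mean, so the invariant carried through the sum also admits the pair
   [(0, 0)]. *)
pose Q (a : R) v := (a = 0 /\ v = 0) \/ (0 < a /\ A (a^-1 *: v)).
suff [[-> _]|[_ //]] : Q (\sum_(i | P i) w i) (\sum_(i | P i) w i *: p i).
  by rewrite ltxx.
apply: big_ind2 => [|a u b v Qu Qv|i /wp[w0 Ap]].
- by left.
- case: Qu => [[-> ->]|[a0 Au]]; first by rewrite !add0r.
  case: Qv => [[-> ->]|[b0 Av]]; first by rewrite !addr0; right.
  have ab0 : 0 < a + b by rewrite addr_gt0.
  right; split=> //.
  have := cA (a / (a + b)) _ _ _ Au Av.
  have -> : 1 - a / (a + b) = b / (a + b).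
    by rewrite -{1}(@divff _ (a + b)) ?gt_eqF// -mulrBl addrAC subrr add0r.
  have cancel c : 0 < c -> c / (a + b) / c = (a + b)^-1.
    by move=> c0; rewrite mulrAC divff ?mul1r ?gt_eqF.
  rewrite !scalerA !cancel// -scalerDr; apply.
  by rewrite ler_pdivrMr// mul1r lerDl divr_ge0 ltW.
- by right; split=> //; rewrite scalerA mulVf ?gt_eqF// scale1r.
Qed.

(** The rows [(p i, 1)] lie in dimension n+1 and number more than that, so they are linearly
    dependent; the last coordinate 1 makes the weights sum to zero. *)
Lemma affine_dependence (R : fieldType) (n k : nat) (p : 'I_k -> 'rV[R]_n) :
  (n.+1 < k)%N ->
  exists w : 'I_k -> R,
    [/\ exists i, w i != 0, \sum_i w i = 0 & \sum_i w i *: p i = 0].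
Proof.
move=> nk.
pose M : 'M[R]_(k, n + 1) := row_mx (\matrix_i p i) (const_mx 1).
have : kermx M != 0.
  rewrite kermx_eq0 /row_free ltn_eqF//.
  by rewrite (leq_ltn_trans (rank_leq_col _))// addn1.
case/rowV0Pn=> v /sub_kermxP; rewrite mul_mx_row -row_mx0.
move=> /eq_row_mx[vp v1] v0.
exists (v 0); split.
- by have /rV0Pn := v0.
- move/matrixP: v1 => /(_ 0 0); rewrite !mxE => {2}<-.
  by apply: eq_bigr => i _; rewrite mxE mulr1.
- by rewrite -[RHS]vp mulmx_sum_row; apply: eq_bigr => i _; rewrite rowK.
Qed.

(* Radon's argument: each w_i p_i below lies on the side of the affine
   dependence that avoids the set C i which p_i may miss. *)
Lemma radon_common_point (R : realType) (n k : nat) (C : 'I_k -> set 'rV[R]_n)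
    (p : 'I_k -> 'rV[R]_n) :
  (n.+1 < k)%N -> (forall i, convex_set (C i)) ->
  (forall i j, i != j -> C i (p j)) ->
  \bigcap_i C i !=set0.
Proof.
move=> nk cC Cp; have [w [[i0 wi0] sw swp]] := affine_dependence p nk.
set s := \sum_(i | 0 < w i) w i.
have splitw (V : zmodType) (f : 'I_k -> V) : \sum_i f i = 0 ->
    \sum_(i | 0 < w i) f i = - \sum_(i | ~~ (0 < w i)) f i.
  by rewrite (bigID (fun i => 0 < w i))/= => /eqP; rewrite addr_eq0 => /eqP.
have drop0 (V : lmodType R) (f : 'I_k -> V) :
    - \sum_(i | ~~ (0 < w i)) w i *: f i = \sum_(i | w i < 0) (- w i) *: f i.
  rewrite (bigID (fun i => w i == 0))/= big1 ?add0r.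
    rewrite -sumrN; apply: eq_big => [i|i _]; last by rewrite scaleNr.
    by rewrite -leNgt lt_neqAle andbC.
  by move=> i /andP[_ /eqP->]; rewrite scale0r.
have sE : s = \sum_(i | w i < 0) - w i.
  (* With all vectors equal to 1 in [R^o], [drop0] speaks of the weights themselves. *)
  have := drop0 R^o (fun=> 1); rewrite /s (splitw _ _ sw).
  under eq_bigr do rewrite [_ *: _]mulr1.
  by move=> ->; apply: eq_bigr => i _; rewrite [_ *: _]mulr1.
have s0 : 0 < s.
  have [wn|wp|w0] := ltgtP (w i0) 0; last by move: wi0; rewrite w0 eqxx.
    rewrite sE (bigD1 i0)//= ltr_pwDl ?oppr_gt0// sumr_ge0// => i /andP[wi _].
    by rewrite oppr_ge0 ltW.
  rewrite /s (bigD1 i0)//= ltr_pwDl// sumr_ge0// => i /andP[wi _].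
  exact: ltW.
(* Radon's point, which is also the mean of the [p i] of negative weight. For each [j], the mean
   that leaves out [p j] is used. *)
exists (s^-1 *: \sum_(i | 0 < w i) w i *: p i) => j _.
have [wj|wj] := ltP 0 (w j).
  rewrite (splitw _ _ swp) drop0 sE; apply: convex_set_weighted_mean => //.
    move=> i wi; split; rewrite ?oppr_gt0//; apply: Cp.
    by apply: contraTneq wi => <-; rewrite -leNgt ltW.
  by rewrite -sE.
apply: convex_set_weighted_mean => // i wi; split=> //; apply: Cp.
by apply: contraTneq wi => <-; rewrite -leNgt.
Qed.

(** Induction on [k]: leaving out each set in turn gives the points [p j] to which Radon's argument
    applies. *)
Lemma helly_ord (R : realType) (n k : nat) (C : 'I_k -> set 'rV[R]_n) :
  (forall i, convex_set (C i)) ->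
  (forall f : 'I_n.+1 -> 'I_k, \bigcap_i C (f i) !=set0) ->
  \bigcap_i C i !=set0.
Proof.
elim: k C => [|k IHk] C cC hC; first by exists 0 => -[].
(* For at most n+1 sets, [inord] runs through all of them; surplus arguments fall on its default
   index 0. *)
have [kn|nk] := leqP k.+1 n.+1.
  have [x Cx] := hC (fun i => inord i); exists x => i _.
  have := Cx (widen_ord kn i) I.
  by congr (C _ _); apply: val_inj; rewrite /= inordK.
have /choice[p Cp] : forall j : 'I_k.+1, exists x, forall i, C (lift j i) x.
  move=> j; have [|f|x Cx] := IHk (fun i => C (lift j i)).
  - by move=> i; exact: cC.
  - exact: (hC (fun i => lift j (f i))).
  - by exists x => i; exact: Cx.
apply: (radon_common_point nk cC) => // i j.
by rewrite eq_sym => /unlift_some[i' -> _]; exact: Cp.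
Qed.

Theorem helly (R : realType) (n : nat) (I : finType) (C : I -> set 'rV[R]_n) :
  (forall i, convex_set (C i)) ->
  (forall f : 'I_n.+1 -> I, \bigcap_i C (f i) !=set0) ->
  \bigcap_i C i !=set0.
Proof.
move=> cC hC.
have [x Cx] := @helly_ord R n #|I| (fun i => C (enum_val i))
  (fun i => cC _) (fun f => hC (fun i => enum_val (f i))).
by exists x => i _; rewrite -(enum_rankK i); exact: Cx.
Qed.

Lemma convex_set_bigcap (R : realType) (E : lmodType R) (I : Type) (D : set I)
    (C : I -> set E) :
  (forall i, D i -> convex_set (C i)) -> convex_set (\bigcap_(i in D) C i).
Proof.
move=> cC; apply/convex_setE => t x y t01 Cx Cy i Di.
by have /convex_setE := cC i Di; apply; [|exact: Cx|exact: Cy].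
Qed.

Lemma helly_finite_hitting (R : realType) (n : nat) (T : Type) (Y : set T)
    (I : finType) (x : I -> 'rV[R]_n) (C : T -> set 'rV[R]_n) :
  Y !=set0 -> (forall y, Y y -> convex_set (C y)) ->
  (forall f : 'I_n.+1 -> T, (forall i, Y (f i)) ->
    exists j, forall i, C (f i) (x j)) ->
  \bigcap_(y in Y) C y !=set0.
Proof.
move=> [y0 Yy0] cC hC.
pose trace y : {set I} := [set j | `[< C y (x j) >]]%SET.
pose D J := \bigcap_(y in [set y | Y y /\ trace y = J]) C y.
have [|f|z Dz] := @helly R n {set I} D.
- by move=> J; apply: convex_set_bigcap => y [Yy _]; exact: cC.
(* One representative per trace. If [J] is no trace, [D J] is the whole space and [y0] is a
   placeholder. *)
- have /choice[g fg] : forall J, exists y,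
      Y y /\ ((exists2 y', Y y' & trace y' = J) -> trace y = J).
    move=> J; have [[y Yy yJ]|nJ] := pselect (exists2 y', Y y' & trace y' = J).
      by exists y.
    by exists y0; split=> // /nJ.
  (* Whether [x j] lies in [C y] depends only on the trace of [y], so a point [x j] common to the
     representatives lies in every [D (f i)]. *)
  have [i|j Cj] := hC (fun i => g (f i)); first by case: (fg (f i)).
  exists (x j) => i _ y [Yy yJ].
  have /setP/(_ j) : trace (g (f i)) = trace y.
    by rewrite yJ; apply: (fg (f i)).2; exists y.
  by rewrite !inE => eC; apply/asboolP; rewrite -eC; apply/asboolP; exact: Cj.
- by exists z => y Yy; exact: (Dz (trace y)).
Qed.

Lemma convex_set_interior (R : realType) (m : nat) (K : set 'rV[R]_m) :
  convex_set K -> convex_set (interior K).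
Proof.
move=> /convex_setE cK; apply/convex_setE => t x y t01.
rewrite /interior/= => /nbhs_ballP[d d0 Kx] /nbhs_ballP[e e0 Ky].
apply/nbhs_ballP; exists (Num.min d e); first by rewrite /= lt_min d0.
set c := t *: x + _ => z; rewrite -ball_normE/= lt_min => /andP[zd ze].
(* Moving both [x] and [y] by [u] moves [c] by [u], so the smaller radius works at [c]. *)
have shift u : t *: (x + u) + (1 - t) *: (y + u) = c + u.
  by rewrite !scalerDr addrACA -scalerDl [t + _]addrC subrK scale1r.
rewrite -[z](subrK c) addrC -shift.
by apply: cK => //; [apply: Kx|apply: Ky];
  rewrite -ball_normE/= opprD addrA subrr add0r opprB.
Qed.

Lemma open_minkowski_sum (R : realType) (m : nat) (A B : set 'rV[R]_m) :
  open B -> open (minkowski_sum A B).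
Proof.
move=> oB.
have -> : minkowski_sum A B = \bigcup_(a in A) ((fun y => y - a) @^-1` B).
  apply/seteqP; split=> [_ [a Aa [b Bb <-]]|y [a Aa /= Bya]].
    by exists a => //=; rewrite addrC addKr.
  by exists a => //; exists (y - a) => //; rewrite addrC subrK.
apply: bigcup_open => a _; apply: open_comp => //.
by move=> y _; apply: continuousB; [exact: cvg_id|exact: cst_continuous].
Qed.

Lemma convex_minkowski_preimage (R : realType) (n m : nat)
    (Omega : set 'rV[R]_n) (F : 'rV[R]_n -> set 'rV[R]_m) (K : set 'rV[R]_m)
    (y : 'rV[R]_m) :
  convex_set Omega -> convex_set (svgraph F) -> convex_set K ->
  convex_set [set x | Omega x /\ minkowski_sum (F x) K y].
Proof.
move=> /convex_setE cO /convex_setE cF /convex_setE cK.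
apply/convex_setE => t x x' t01 [Ox [a Fa [k Kk ky]]] [Ox' [b Fb [l Kl ly]]].
split; first exact: cO.
exists (t *: a + (1 - t) *: b); first exact: (cF t (x, a) (x', b)).
exists (t *: k + (1 - t) *: l); first exact: cK.
by rewrite addrACA -!scalerDr ky ly -scalerDl addrC subrK scale1r.
Qed.

(** An [x'] that beats [x] in the set order offers, below each [y i], some point of [F x']; together
    these beat the tuple. *)
Lemma wargminx_VP_sub (R : realType) (n m p : nat)
    (Omega : set 'rV[R]_n) (F : 'rV[R]_n -> set 'rV[R]_m) (K : set 'rV[R]_m) :
  wargminx_VP Omega F K p `<=` wargmin_SP Omega F K.
Proof.
move=> _ [[x y] [[/= Ox Fy] min_xy] <-]; split=> //= -[x' [Ox' Fxx']].
apply: min_xy.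
have /choice[y' y'P] : forall i, exists z, F x' z /\ interior K (y i - z).
  move=> i; have [z Fz [k Kk zk]] := Fxx' _ (Fy i).
  by exists z; rewrite -zk addrC addKr.
by exists (x', y'); split=> [|i]; [split=> //= i|]; case: (y'P i).
Qed.

(* [compact_In0] is stated for pointed spaces. *)
HB.instance Definition _ (U : Type) (T : U -> ptopologicalType) :=
  Pointed.copy (prod_topology T) (forall x : U, T x).

Theorem theorem4p16 (R : realType) (n m : nat)
  (Omega : set 'rV[R]_n) (F : 'rV[R]_n -> set 'rV[R]_m) (K : set 'rV[R]_m)
  (Omega_nonempty : Omega !=set0)
  (Omega_closed : closed Omega)
  (Omega_dom : Omega `<=` svdom F)
  (F_compact : forall x, Omega x -> compact (F x))
  (K_cone : is_cone K)
  (K_closed : closed K)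
  (K_convex : convex_set K)
  (K_pointed : is_pointed K)
  (K_solid : is_solid K)
  (Omega_convex : convex_set Omega)
  (Omega_int_dom : Omega `<=` interior (svdom F))
  (F_convex : convex_set (svgraph F))
  (F_bounded : forall x, Omega x -> locally_bounded_at F x) :
  wFDVP_with Omega F K n.+1.
Proof.
apply/seteqP; split=> [|xbar [Oxbar min_xbar]]; first exact: wargminx_VP_sub.
pose dominated x y := minkowski_sum (F x) (interior K) y.
pose P := [set y : {ptws 'I_n.+1 -> 'rV[R]_m} | forall i, F xbar (y i)].
have : compact P.
  apply: (@tychonoff _ (fun=> 'rV[R]_m) (fun=> F xbar)) => _.
  exact: F_compact.
(* [W x] holds the tuples with an entry that [x] does not dominate. A tuple of [P] lying in [W x]
   for all [x] in [Omega] is weakly minimal together with [xbar]. *)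
pose W x := \bigcup_i (@proj 'I_n.+1 (fun=> 'rV[R]_m) i @^-1` (~` dominated x)).
rewrite compact_In0 => /(_ _ Omega (fun x => P `&` W x))[||y Py].
- exists W => // x _.
  apply: closed_bigcup => [|i _]; first exact: finite_finset.
  rewrite -openC -preimage_setC setCK.
  apply: open_comp => [y _|]; first exact: proj_continuous.
  by apply: open_minkowski_sum; exact: open_interior.
(* If each tuple of [P] is dominated in all entries by some point of [D], Helly yields one point of
   [Omega] dominating all of [F xbar]. *)
- move=> D DO; apply: contrapT => nW; apply: min_xbar.
  have [||f Ff|x Cx] := @helly_finite_hitting R n _ (F xbar) D val
    (fun y => [set x | Omega x /\ dominated x y]).
  + exact: Omega_dom.
  + move=> y _; apply: convex_minkowski_preimage => //.
    exact: convex_set_interior.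
  + apply: contrapT => nx; apply: nW; exists f => x Dx; split=> //.
    apply: contrapT => nW; apply: nx; exists [` Dx]%fset => i.
    split; first by move: (DO _ Dx); rewrite inE.
    by apply: contrapT => nd; apply: nW; exists i.
  + have [y0 Fy0] := Omega_dom _ Oxbar.
    by exists x; split=> [|y Fy]; [case: (Cx _ Fy0)|case: (Cx _ Fy)].
(* The tuple belongs to [P] because [xbar] is itself an index of the family. *)
- exists (xbar, y) => //; split; first by split=> //= i; case: (Py _ Oxbar).
  move=> [[x z] [[/= Ox Fz] yz]]; have [_ [i _]] := Py _ Ox; apply.
  exists (z i) => //; exists (y i - z i); first exact: yz.
  by rewrite addrC subrK.
Qed.
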